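(* For each $n$, both sets $$\{\boldsymbol\eta_{(B,\sigma)}: B\subseteq\{2,\dots,n-1\}\text{ a peak set},\ \sigma\in\mathfrak S_n,\ (B,\sigma)\text{ enriched standard}\}$$ and $$\{\mathbf K_{(B,\sigma)}: B\subseteq\{2,\dots,n-1\}\text{ a peak set},\ \sigma\in\mathfrak S_n,\ (B,\sigma)\text{ enriched standard}\}$$ are bases of $\mathrm{NC}\Pi_n$. Moreover, $\dim(\mathrm{NC}\Pi_n)$ equals the number of odd set compositions of $[n]$.
   Context: Let $\mathbf x_1,\mathbf x_2,\dots$ be noncommuting variables over $\mathbb Q$; $[m]=\{1,\dots,m\}$. A set composition of $[n]$ is a sequence of pairwise disjoint nonempty sets (blocks) with union $[n]$; it is odd if all blocks have odd size. Totally order the nonzero integers by $-1\prec1\prec-2\prec2\prec\cdots$. A labelled poset is $(P,\gamma)$ with $P$ a poset on an $n$-element set $X$ and $\gamma:X\to[n]$ a bijection; an enriched $(P,\gamma)$-partition is $f:X\to\mathbb Z\setminus\{0\}$ such that for all $a\le b$ in $P$: $f(a)\preceq f(b)$; $f(a)=f(b)>0$ implies $\gamma(a)<\gamma(b)$; $f(a)=f(b)<0$ implies $\gamma(a)>\gamma(b)$. For a further bijection $\sigma:X\to[n]$, $\mathbf K_{(P,\gamma,\sigma)}=\sum_f\mathbf x_{|f(\sigma^{-1}(1))|}\mathbf x_{|f(\sigma^{-1}(2))|}\cdots\mathbf x_{|f(\sigma^{-1}(n))|}$ over all enriched $(P,\gamma)$-partitions $f$. $\mathrm{NC}\Pi_n$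 is the $\mathbb Q$-span of all $\mathbf K_{(P,\gamma,\sigma)}$ with $|X|=n$. For $\gamma,\sigma\in\mathfrak S_n$, write $\mathbf K_{(\gamma,\sigma)}=\mathbf K_{(P,\gamma,\sigma)}$ with $P$ the chain $1<2<\cdots<n$ on $X=[n]$. $\mathrm{Peak}(\gamma)=\{i\in\{2,\dots,n-1\}:\gamma(i-1)<\gamma(i)>\gamma(i+1)\}$. A peak set is a subset of $\{2,\dots,n-1\}$ with no two consecutive integers; every peak set is $\mathrm{Peak}(\gamma)$ for some $\gamma$, $\mathbf K_{(\gamma,\sigma)}$ depends only on $\mathrm{Peak}(\gamma)$ and $\sigma$, and $\mathbf K_{(B,\sigma)}:=\mathbf K_{(\gamma,\sigma)}$ for any $\gamma$ with $\mathrm{Peak}(\gamma)=B$. $\boldsymbol\eta_{(B,\sigma)}=\sum_{C\subseteq B}(-1)^{|B|-|C|}\mathbf K_{(C,\sigma)}$. $\mathrm{Odd}(B)=[n-1]\setminus(B\cup(B-1))$, $\mathrm{Des}(\sigma)=\{i:\sigma(i)>\sigma(i+1)\}$, and $(B,\sigma)$ is enriched standard if $\mathrm{Des}(\sigma)\subseteq\mathrm{Odd}(B)$.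
   Formalization: In the definition of an enriched (P,γ)-partition the conditions are imposed for a < b in P rather than for all a ≤ b; with a = b allowed no such partition would exist for n ≥ 1, and every K would vanish. *)

(* Defs.v *)
From HB Require Import structures.
From mathcomp Require Import all_boot all_order all_fingroup all_algebra.
From mathcomp Require Import finmap.
From mathcomp Require Import mathcomp_extra boolp classical_sets functions
  cardinality.

Set Implicit Arguments.
Unset Strict Implicit.
Unset Printing Implicit Defensive.

Import Order.TTheory GRing.Theory Num.Theory.

Local Open Scope ring_scope.

(* The underlying Q-vector space of Q<<x_1, x_2, ...>>: a series is its
   coefficient function, and the word [:: k_1; ...; k_m] : seq nat stands for
   the monomial x_(k_1 + 1) ... x_(k_m + 1). *)
Definition ncseries := seq nat -> rat^o.

HB.instance Definition _ := GRing.Lmodule.copy ncseries (seq nat -> rat^o).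

Section LinearAlgebra.
Variable V : lmodType rat.

Definition lin_span (S : set V) : set V :=
  [set v | exists (k : nat) (c : 'I_k -> rat) (g : 'I_k -> V),
     (forall i, S (g i)) /\ v = \sum_(i < k) c i *: g i]%classic.

Definition is_basis (I : finType) (A : {set I}) (v : I -> V) (W : set V) :
    Prop :=
  lin_span (fun w => exists2 i, i \in A & w = v i) = W /\
  (forall c : I -> rat,
     \sum_(i in A) c i *: v i = 0 -> forall i, i \in A -> c i = 0).

Definition has_dim (W : set V) (N : nat) : Prop :=
  exists b : 'I_N -> V, is_basis [set: 'I_N]%SET b W.

End LinearAlgebra.

(* The order -1 < 1 < -2 < 2 < ... on nonzero integers. *)
Definition eple (a b : int) : bool :=
  (`|a| < `|b|)%N || ((`|a|%N == `|b|%N) && (a <= b)).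

(* Elements of [n] are represented by 'I_n, with i : 'I_n standing for i + 1. *)

Section Enriched.
Variables (d : Order.disp_t) (X : finPOrderType d) (n : nat).

(* The pairs a <= b are restricted to a < b: for a = b the last two conditions
   could never hold. *)
Definition enriched_partition (g : X -> 'I_n) (f : X -> int) : Prop :=
  (forall a, f a != 0) /\
  (forall a b : X, (a < b)%O ->
     [/\ eple (f a) (f b),
         f a = f b -> 0 < f a -> (g a < g b)%N
       & f a = f b -> f a < 0 -> (g a > g b)%N]).

(* w is the word of x_|f(s^-1(1))| ... x_|f(s^-1(n))| (s is a bijection): its
   letter at position s a is |f a|, stored with the shift of [ncseries]. *)
Definition has_word (s : X -> 'I_n) (f : X -> int) (w : seq nat) : Prop :=
  size w = n /\ forall a : X, `|f a|%N = (nth 0%N w (s a)).+1.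

(* The coefficient of a word is the number of enriched partitions with that
   word; this set is finite, since |f| is prescribed. *)
Definition Kposet (g s : X -> 'I_n) : ncseries := fun w =>
  (#|` fset_set [set f : {ffun X -> int} |
        enriched_partition g f /\ has_word s f w]%classic |)%:R.

End Enriched.

Definition NCPi_gen (n : nat) : set ncseries :=
  [set F | exists (d : Order.disp_t) (X : finPOrderType d) (g s : X -> 'I_n),
     [/\ bijective g, bijective s & F = Kposet g s]]%classic.

Definition NCPi (n : nat) : set ncseries := lin_span (@NCPi_gen n).

Section PeakSets.
Variable n : nat.

Definition Kchain (g s : 'S_n) : ncseries := @Kposet _ 'I_n n g s.

Definition Peak (g : 'S_n) : {set 'I_n} :=
  [set i : 'I_n | [exists j : 'I_n, exists k : 'I_n,
     [&& i == j.+1 :> nat, k == i.+1 :> nat, (g j < g i)%N & (g k < g i)%N]]]%SET.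

Definition peak_set (B : {set 'I_n}) : bool :=
  [forall i in B, (0 < i)%N && (i.+1 < n)%N] &&
  [forall i in B, forall j in B, j != i.+1 :> nat].

(* The value does not depend on the choice of g with Peak g = B, and such a g
   exists as soon as B is a peak set; the value 0 is for other B. *)
Definition Kpeak (B : {set 'I_n}) (s : 'S_n) : ncseries :=
  if [pick g : 'S_n | Peak g == B] is Some g then Kchain g s else 0.

Definition eta (B : {set 'I_n}) (s : 'S_n) : ncseries :=
  \sum_(C : {set 'I_n} | C \subset B) (-1) ^+ (#|B| - #|C|) *: Kpeak C s.

Definition Odd (B : {set 'I_n}) : {set 'I_n} :=
  [set i : 'I_n | [&& (i.+1 < n)%N, i \notin B &
     [forall j in B, j != i.+1 :> nat]]]%SET.

Definition Des (s : 'S_n) : {set 'I_n} :=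
  [set i : 'I_n | [exists j : 'I_n, (j == i.+1 :> nat) && (s j < s i)%N]]%SET.

Definition enriched_standard (B : {set 'I_n}) (s : 'S_n) : bool :=
  Des s \subset Odd B.

Definition std_pairs : {set {set 'I_n} * 'S_n} :=
  [set p : {set 'I_n} * 'S_n | peak_set p.1 && enriched_standard p.1 p.2]%SET.

End PeakSets.

Definition set_composition (n : nat) (c : seq {set 'I_n}) : bool :=
  [&& finset.set0 \notin c,
      pairwise (fun A B : {set 'I_n} => [disjoint A & B]) c
    & [forall i : 'I_n, has (fun A : {set 'I_n} => i \in A) c]].

Definition odd_set_composition (n : nat) (c : seq {set 'I_n}) : bool :=
  set_composition c && all (fun A : {set 'I_n} => odd #|A|) c.

Definition num_odd_set_compositions (n : nat) : nat :=
  #|` fset_set [set c : seq {set 'I_n} | odd_set_composition c]%classic |.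

(* Main.v *)
(** For a fixed word the absolute values of f are prescribed, so only the signs
    vary. On a chain the constraints on the signs decouple: with a = w o sigma,
    the sign of f(i) is forced to be positive when a(i-1) = a(i) and gamma
    ascends at i - 1, negative when a(i) = a(i+1) and gamma descends at i, and is
    free otherwise. A conflict occurs exactly at a peak i with
    a(i-1) = a(i) = a(i+1), so the coefficient of w in K_(B,sigma) is a nonzero
    weight depending only on a, times the product over i in B of
    1 - [a(i-1) = a(i) = a(i+1)]; inclusion-exclusion turns this product into
    that of -[a(i-1) = a(i) = a(i+1)] for eta_(B,sigma). Hence, up to sign, eta
    only depends on the set composition obtained by cutting sigma at Odd(B), all
    of whose blocks are odd, and one may sort sigma inside the blocks; this and
    the decomposition of K_(P,gamma,sigma) over linear extensions give spanning.
    The word numbering the blocks of (B,sigma) has a nonzero coefficient only in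
    eta's of finer set compositions, which gives independence. The K's follow by
    triangularity, since C <= B preserves enriched standardness. *)

Require Import Defs.
From mathcomp Require Import finmap boolp classical_sets cardinality.
From mathcomp Require Import all_boot all_order all_fingroup all_algebra.
From mathcomp Require Import zify ring.

Set Implicit Arguments.
Unset Strict Implicit.
Unset Printing Implicit Defensive.

Import Order.TTheory GRing.Theory Num.Theory.

(** * Monotone maps and ranks *)

Lemma ord_homo (T : Type) (r : T -> T -> Prop) (n : nat) (a : 'I_n -> T) :
  (forall x y z, r x y -> r y z -> r x z) ->
  (forall i j : 'I_n, j = i.+1 :> nat -> r (a i) (a j)) ->
  forall i j : 'I_n, i < j -> r (a i) (a j).
Proof.
move=> tr adj i [j jn] /=; elim: j jn => // j IHj jn.
rewrite ltnS leq_eqVlt => /orP[/eqP ij|ij].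
  by apply: adj; rewrite /= ij.
by apply: (tr _ (a (Ordinal (ltnW jn)))); [exact: IHj | exact: adj].
Qed.

Lemma ltn_of_homo (n : nat) (a : 'I_n -> nat) :
  (forall i j : 'I_n, i < j -> a i < a j) ->
  forall i j : 'I_n, (a i < a j) = (i < j).
Proof.
move=> H i j; case: (ltngtP i j) => [/H ->//|/H|/val_inj ->]; last by rewrite ltnn.
by move/ltnW; rewrite leqNgt => /negbTE.
Qed.

Lemma card_lt_ord (n k : nat) : k <= n -> #|[set j : 'I_n | j < k]| = k.
Proof.
move=> kn; have wI : injective (widen_ord kn) by move=> x y [] /val_inj.
rewrite -[RHS](card_ord k) -cardsT -(card_imset _ wI).
apply: eq_card => j; rewrite inE; apply/idP/imsetP => [jk|[i _ ->]].
  by exists (Ordinal jk) => //; apply: val_inj.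
exact: (ltn_ord i).
Qed.

Lemma perm_rank (n : nat) (k : 'I_n -> nat) : injective k ->
  exists r : 'S_n, forall i j, (r i < r j) = (k i < k j).
Proof.
move=> kI; pose R i := #|[set j | k j < k i]|.
have Rlt i : R i < n.
  rewrite -[X in _ < X]card_ord -cardsT; apply: proper_card.
  by rewrite properT; apply/eqP => /setP/(_ i); rewrite !inE ltnn.
have Rmono i j : k i < k j -> R i < R j.
  move=> ij; apply: proper_card; rewrite properE; apply/andP; split.
    by apply/subsetP => x; rewrite !inE => /ltn_trans; apply.
  by apply/negP => /subsetP/(_ i); rewrite !inE ltnn => /(_ ij).
have RE i j : (R i < R j) = (k i < k j).
  case: (ltngtP (k i) (k j)) => [/Rmono ->//|/Rmono|/kI ->]; last by rewrite ltnn.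
  by move/ltnW; rewrite leqNgt => /negbTE.
have RI : injective (fun i => Ordinal (Rlt i)).
  move=> i j [] eq; apply: kI; move: (RE i j) (RE j i).
  by rewrite eq ltnn; case: ltngtP.
by exists (perm RI) => i j; rewrite !permE /= RE.
Qed.

Lemma perm_sort (n : nat) (k : 'I_n -> nat) : injective k ->
  exists r : 'S_n, forall i j, (k (r i) < k (r j)) = (i < j).
Proof.
move=> /perm_rank[r rE]; exists (r^-1)%g => i j.
by rewrite -rE !permKV.
Qed.

(** An ordinal equals the number of ordinals below it, and an increasing [r] maps those below [i]
    onto those below [r i]. *)
Lemma perm_mono_id (n : nat) (r : 'S_n) :
  (forall i j : 'I_n, i < j -> r i < r j) -> r = 1%g.
Proof.
move=> /ltn_of_homo H; apply/permP => i; rewrite perm1; apply: val_inj => /=.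
rewrite -(card_lt_ord (ltnW (ltn_ord (r i)))) -(card_lt_ord (ltnW (ltn_ord i))).
rewrite -[RHS](card_imset _ (@perm_inj _ r)); apply: eq_card => j; rewrite inE.
apply/idP/imsetP => [ji|[x]]; last by rewrite inE -H => xi ->.
by exists (r^-1 j)%g; rewrite ?permKV // inE -H permKV.
Qed.

Lemma perm_sort_uniq (n : nat) (k : 'I_n -> nat) (r s : 'S_n) :
  (forall i j : 'I_n, i < j -> k (r i) < k (r j)) ->
  (forall i j : 'I_n, i < j -> k (s i) < k (s j)) -> r = s.
Proof.
move=> Hr Hs; apply/(mulIg s^-1)%g; rewrite mulgV; apply: perm_mono_id => i j ij.
have /ltn_of_homo <- := Hs; by rewrite !permM !permKV; apply: Hr.
Qed.

(** Both sides list the same multiset of values in weakly increasing order. *)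
Lemma perm_sorted_eq (n : nat) (a : 'I_n -> nat) (r : 'S_n) :
  (forall i j : 'I_n, i < j -> a i <= a j) ->
  (forall i j : 'I_n, i < j -> a (r i) <= a (r j)) ->
  forall i, a (r i) = a i.
Proof.
move=> Ha Har i.
suff /eq_in_map/(_ i (mem_enum _ _)) :
  [seq a (r x) | x <- enum 'I_n] = [seq a x | x <- enum 'I_n] by [].
have srt (b : 'I_n -> nat) : (forall i j : 'I_n, i < j -> b i <= b j) ->
  sorted leq [seq b x | x <- enum 'I_n].
  move=> Hb; rewrite sorted_map; apply: (@sub_sorted _ (relpre val ltn)).
    by move=> x y /Hb.
  by rewrite -sorted_map val_enum_ord iota_ltn_sorted.
apply: (sorted_eq leq_trans anti_leq); [exact: srt|exact: srt|].
rewrite (map_comp a r); apply: perm_map; apply: uniq_perm.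
- by rewrite map_inj_uniq ?enum_uniq //; apply: perm_inj.
- exact: enum_uniq.
- move=> x; rewrite mem_enum inE; apply/mapP.
  by exists (r^-1 x)%g; rewrite ?permKV ?mem_enum.
Qed.

(** Converts the cardinals of classical sets in [Kposet] and [num_odd_set_compositions] into
    cardinals over finite types. *)
Lemma card_fset_set_image (T : finType) (U : choiceType) (A : {set T})
    (F : T -> U) (S : classical_sets.set U) :
  {in A &, injective F} ->
  (forall u, S u <-> exists2 t, t \in A & u = F t) ->
  #|` fset_set S| = #|A|.
Proof.
move=> FI SE.
have -> : S = [set` [fset F t | t in A]%fset]%classic.
  apply/seteqP; split => u /=; rewrite SE.
    by case=> t tA ->; apply/imfsetP; exists t.
  by move/imfsetP => [t /= tA ->]; exists t.
rewrite set_fsetK card_in_imfset /=; last by move=> x y xA yA; apply: FI.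
by rewrite cardE.
Qed.

(** * Sign vectors and the fundamental lemma *)

(* Order-preserving encoding of the triples (|f|, sign, +-label): a map is an
   enriched partition iff its key is strictly increasing. The labels of
   negative values count backwards. *)
Definition enr_key (n w : nat) (pos : bool) (g : nat) : nat :=
  w * n.*2 + (if pos then n + g else n - g.+1).

Lemma enr_key_bound (n w g : nat) (pos : bool) : g < n ->
  w * n.*2 <= enr_key n w pos g < w.+1 * n.*2.
Proof.
by move=> gn; rewrite /enr_key mulSn; case: pos; apply/andP; split; lia.
Qed.

(** Distinct absolute values have disjoint windows of width [2n]. Inside one window, negative values
    fill the lower half with labels reversed and positive ones the upper half, which gives the two
    tie rules. *)
Lemma enr_keyP (n wx wy gx gy : nat) (x y : int) :
  gx < n -> gy < n -> `|x|%N = wx.+1 -> `|y|%N = wy.+1 ->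
  [/\ eple x y, x = y -> (0 < x)%R -> gx < gy & x = y -> (x < 0)%R -> gx > gy]
  <-> enr_key n wx (0 < x)%R gx < enr_key n wy (0 < y)%R gy.
Proof.
move=> gxn gyn xw yw; rewrite /eple xw yw ltnS eqSS /enr_key.
move: (enr_key_bound wx (0 < x)%R gxn) (enr_key_bound wy (0 < y)%R gyn).
rewrite /enr_key => /andP[x1 x2] /andP[y1 y2].
case: (ltngtP wx wy) => [lt|gt|eq] /=.
- have := leq_mul lt (leqnn n.*2); split; [by lia|].
  by move=> _; split=> // xy; rewrite -xy in yw; lia.
- have := leq_mul gt (leqnn n.*2); split; [by case|lia].
- rewrite -eq ltn_add2l; clear x1 x2 y1 y2.
  case: (ltrgt0P x) => x0; case: (ltrgt0P y) => y0; try lia.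
  + have -> : x = y by lia.
    by rewrite lexx; split => [[_ /(_ erefl)]|]; [lia | move=> ?; split=> //; lia].
  + by split=> [[]|]; lia.
  + by split => _; [lia | split; lia].
  + have -> : x = y by lia.
    by rewrite lexx; split => [[_ _ /(_ erefl)]|]; [lia | move=> ?; split=> //; lia].
Qed.

Section Signs.
Variables (d : Order.disp_t) (X : finPOrderType d) (n : nat).

(* [e] is the set of elements with positive value. *)
Definition sign_key (g : X -> 'I_n) (a : X -> nat) (e : {set X}) (x : X) : nat :=
  enr_key n (a x) (x \in e) (g x).

Definition good_signs (g : X -> 'I_n) (a : X -> nat) : {set {set X}} :=
  [set e : {set X} | [forall x, forall y, (x < y)%O ==>
     (sign_key g a e x < sign_key g a e y)]].

(** The word fixes all absolute values, so [f] is determined by where it is positive; [F] rebuilds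
    it, undoing the shift by 1 of the stored letters. *)
Lemma Kposet_card (g s : X -> 'I_n) (w : seq nat) : bijective s ->
  Kposet g s w =
    if size w == n then #|good_signs g (fun x => nth 0 w (s x))|%:R%R else 0%R.
Proof.
move=> sB; rewrite /Kposet; case: eqP => [wn|wn]; last first.
  rewrite (_ : classical_sets.mkset _ = classical_sets.set0) ?fset_set0 ?cardfs0 //.
  by apply/seteqP; split=> f //= [_ [/wn]].
congr _%:R%R; set a := fun x => nth 0 w (s x).
pose F (e : {set X}) : {ffun X -> int} :=
  [ffun x => if x \in e then Posz (a x).+1 else (- Posz (a x).+1)%R].
have Fpos e x : (0 < F e x)%R = (x \in e) by rewrite ffunE; case: ifP => _; lia.
have Fabs e x : `|F e x|%N = (a x).+1 by rewrite ffunE; case: ifP => _; lia.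
apply: (card_fset_set_image (F := F)).
  by move=> e e' _ _ eq; apply/setP => x; rewrite -!Fpos eq.
move=> f; split.
  move=> [[f0 fE] [_ fw]].
  have fF : f = F [set x | (0 < f x)%R].
    apply/ffunP => x; rewrite ffunE inE; have := f0 x; have := fw x.
    by rewrite -/(a x); case: ltrgt0P => /=; lia.
  exists [set x | (0 < f x)%R] => //; rewrite inE.
  apply/forallP => x; apply/forallP => y; apply/implyP => xy.
  rewrite /sign_key !inE; apply/(@enr_keyP n _ _ _ _ (f x) (f y)) => //.
  exact: fE.
move=> [e]; rewrite inE => /forallP eG ->; split; split => //.
- by move=> x; have := Fabs e x; case: eqP => // ->.
- move=> x y xy; apply/(@enr_keyP n (a x) (a y)) => //.
  by rewrite !Fpos; apply: (implyP (forallP (eG x) y)).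
Qed.

End Signs.

Lemma sign_key_inj (d : Order.disp_t) (X : finPOrderType d) (n : nat)
    (g : X -> 'I_n) (a : X -> nat) (e : {set X}) :
  injective g -> injective (sign_key g a e).
Proof.
move=> gI x y; rewrite /sign_key /enr_key => eq.
have bound z := enr_key_bound (a z) (z \in e) (ltn_ord (g z)).
have axy : a x = a y.
  move: (bound x) (bound y); rewrite /enr_key eq => /andP[x1 x2] /andP[y1 y2].
  have := leq_ltn_trans x1 y2; have := leq_ltn_trans y1 x2.
  by rewrite !ltn_mul2r => /andP[_ ?] /andP[_ ?]; lia.
apply: gI; apply: val_inj => /=; move: eq; rewrite axy => /addnI.
have := ltn_ord (g x); have := ltn_ord (g y).
by case: (x \in e) (y \in e) => [] []; lia.
Qed.

(** [p] lists [X], each element named by its [s]-value; [p^-1 (s x)] is the place of [x] in the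
    list. *)
Definition linear_extension (d : Order.disp_t) (X : finPOrderType d) (n : nat)
    (s : X -> 'I_n) (p : 'S_n) : bool :=
  [forall x, forall y, (x < y)%O ==> ((p^-1)%g (s x) < (p^-1)%g (s y))].

(** Fundamental lemma of P-partitions. The key of a sign choice is injective, so it sorts [X] along
    exactly one [p]; the choice is good iff this [p] is a linear extension, and it then becomes a
    good choice on a chain. *)
Lemma card_good_signs (d : Order.disp_t) (X : finPOrderType d) (n : nat)
    (g s : X -> 'I_n) (t : 'I_n -> X) (h : 'S_n) (u : 'I_n -> nat) :
  cancel s t -> cancel t s -> (forall i, h i = g (t i)) ->
  #|good_signs g (fun x => u (s x))| =
  \sum_(p : 'S_n | linear_extension s p) #|good_signs (p * h)%g (fun i => u (p i))|.
Proof.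
move=> sK tK hE; pose k e := sign_key g (fun x => u (s x)) e.
have gI : injective g.
  have gE x : g x = h (s x) by rewrite hE sK.
  by move=> x y; rewrite !gE => /perm_inj/(can_inj sK).
have kI e : injective (k e) by apply: sign_key_inj.
(* [p] is the order in which the key of [e] lists [X]; as each [e] has exactly one such [p], good
   choices can be counted by [p]. *)
pose inc (e : {set X}) (p : 'S_n) :=
  [forall i : 'I_n, forall j : 'I_n, (i < j) ==> (k e (t (p i)) < k e (t (p j)))].
have incP e p : inc e p -> forall i j : 'I_n, (k e (t (p i)) < k e (t (p j))) = (i < j).
  move=> H; apply: (@ltn_of_homo _ (fun i => k e (t (p i)))) => i j.
  exact: (implyP (forallP (forallP H i) j)).
have inc1 e : \sum_(p : 'S_n) inc e p = 1.
  have ktI : injective (fun i => k e (t i)) by move=> i j /kI /(can_inj tK).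
  have [p pE] := perm_sort ktI.
  have pI : inc e p.
    by apply/forallP => i; apply/forallP => j; apply/implyP; rewrite pE.
  rewrite (bigD1 p) //= pI big1 ?addn0 // => q qp.
  case qI : (inc e q) => //; case/eqP: qp; symmetry.
  by apply: (@perm_sort_uniq _ (fun i => k e (t i))) => i j; rewrite incP.
have -> : #|good_signs g (fun x => u (s x))|
   = \sum_(e in good_signs g (fun x => u (s x))) \sum_(p : 'S_n) inc e p.
  by rewrite -sum1_card; apply: eq_bigr => e _; rewrite inc1.
rewrite exchange_big /= [RHS]big_mkcond /=; apply: eq_bigr => p _.
have goodE e : inc e p -> (e \in good_signs g (fun x => u (s x))) = linear_extension s p.
  move=> eI; rewrite inE; apply: eq_forallb => x; apply: eq_forallb => y.
  by rewrite -(incP _ _ eI) !permKV !sK.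
have -> : \sum_(e in good_signs g (fun x => u (s x))) inc e p =
    if linear_extension s p then \sum_(e : {set X}) inc e p else 0.
  case: ifP => L.
    rewrite [RHS](bigID (fun e => e \in good_signs g (fun x => u (s x)))) /=.
    rewrite [X in _ + X]big1 ?addn0 // => e eG.
    by case eI : (inc e p) => //; rewrite goodE ?L in eG.
  by apply: big1 => e eG; case eI : (inc e p) => //; rewrite goodE ?L in eG.
case: ifP => // _; have tpI : injective (fun i => t (p i)).
  by move=> i j /(can_inj tK) /perm_inj.
have keyE e i : k e (t (p i)) =
    sign_key (p * h)%g (fun i => u (p i)) [set i | t (p i) \in e] i.
  by rewrite /k /sign_key inE permM hE tK.
pose phi (e : {set X}) : {set 'I_n} := [set i | t (p i) \in e].
have phiI : injective phi.
  move=> e e' /setP eq; apply/setP => x; have := eq ((p^-1)%g (s x)).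
  by rewrite !inE permKV sK.
have -> : \sum_(e : {set X}) inc e p = #|[set e | inc e p]|.
  by rewrite -sum1dep_card [RHS]big_mkcond; apply: eq_bigr.
rewrite -(card_imset _ phiI); apply: eq_card => e.
have phie : e = phi [set t (p i) | i in e].
  by apply/setP => i; rewrite inE mem_imset.
have incE e' : (phi e' \in good_signs (p * h)%g (fun i => u (p i))) = inc e' p.
  rewrite inE; apply: eq_forallb => i; apply: eq_forallb => j.
  by rewrite !keyE ltEord.
apply/imsetP/idP => [[e' e'I ->]|]; first by rewrite incE; rewrite inE in e'I.
by rewrite {1}phie incE => eI; exists [set t (p i) | i in e]; rewrite ?inE.
Qed.

(** * Coefficients on chains *)

Lemma ncseries_sumE (I : finType) (P : pred I) (F : I -> ncseries) (w : seq nat) :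
  (\sum_(i | P i) F i)%R w = (\sum_(i | P i) F i w)%R.
Proof. by elim/big_rec2: _ => //= i y1 y2 _ <-. Qed.

Section Chains.
Variable n : nat.
Implicit Types (a : 'I_n -> nat) (g s : 'S_n) (B C : {set 'I_n}).

Definition weakinc a : bool :=
  [forall i : 'I_n, forall j : 'I_n, (j == i.+1 :> nat) ==> (a i <= a j)].

Definition flat a (i : 'I_n) : bool :=
  [exists j : 'I_n, exists k : 'I_n,
     [&& i == j.+1 :> nat, k == i.+1 :> nat, a j == a i & a i == a k]].

Definition level a : {set 'I_n} :=
  [set i : 'I_n | [exists j : 'I_n, (j == i.+1 :> nat) && (a i == a j)]].

Lemma weakincP a : reflect (forall i j : 'I_n, i < j -> a i <= a j) (weakinc a).
Proof.
apply: (iffP forallP) => [H|H i]; last first.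
  by apply/forallP => j; apply/implyP => /eqP ij; apply: H; rewrite ij.
apply: (@ord_homo _ (fun x y => is_true (x <= y))) => [x y z|i j ij].
  exact: leq_trans.
by apply: (implyP (forallP (H i) j)); rewrite ij.
Qed.

Definition forced_pos g a : {set 'I_n} :=
  [set j : 'I_n | [exists i : 'I_n,
     [&& j == i.+1 :> nat, a i == a j & g i < g j]]].

Definition forced_neg g a : {set 'I_n} :=
  [set i : 'I_n | [exists j : 'I_n,
     [&& j == i.+1 :> nat, a i == a j & g j < g i]]].

(** By transitivity only consecutive elements matter. A tie at an ascent of [g] allows the signs -+
    and ++, a tie at a descent -+ and --, so each tie constrains a single sign. *)
Lemma good_signs_chain g a (e : {set 'I_n}) :
  (e \in good_signs g a) =
  [&& weakinc a, forced_pos g a \subset e & e \subset ~: forced_neg g a].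
Proof.
have keyE (i j : 'I_n) : i != j -> (sign_key g a e i < sign_key g a e j) =
  (a i < a j) || [&& a i == a j, (g i < g j) ==> (j \in e) & (g j < g i) ==> (i \notin e)].
  move=> ij; have gij : g i != g j :> nat by apply: contra ij => /eqP /val_inj/perm_inj ->.
  have := ltn_ord (g i); have := ltn_ord (g j); rewrite /sign_key /enr_key.
  case: (ltngtP (a i) (a j)) => /= [aij|aij|->].
  - by have := leq_mul aij (leqnn n.*2); case: (i \in e) (j \in e) => [] []; lia.
  - by have := leq_mul aij (leqnn n.*2); case: (i \in e) (j \in e) => [] []; lia.
  - by rewrite ltn_add2l; case: (i \in e) (j \in e) => [] []; lia.
have neq (i j : 'I_n) : j = i.+1 :> nat -> i != j.
  by move=> ij; apply/eqP => /(congr1 val) /=; lia.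
rewrite inE; apply/idP/and3P => [/forallP G|[/forallP W /subsetP P /subsetP N]].
  have {}G (i j : 'I_n) : j = i.+1 :> nat -> sign_key g a e i < sign_key g a e j.
    by move=> ij; apply: (implyP (forallP (G i) j)); rewrite ltEord /= ij.
  split.
  - apply/forallP => i; apply/forallP => j; apply/implyP => /eqP ij.
    by have := G i j ij; rewrite keyE ?neq // => /orP[/ltnW //|/andP[/eqP ->]].
  - apply/subsetP => j; rewrite inE => /existsP[i /and3P[/eqP ij /eqP aij gij]].
    by have := G i j ij; rewrite keyE ?neq // aij ltnn gij /= => /and3P[_ ->].
  - apply/subsetP => i ie; rewrite !inE; apply/negP => /existsP[j /and3P[/eqP ij /eqP aij gij]].
    by have := G i j ij; rewrite keyE ?neq // aij ltnn gij ie /= !andbF.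
apply/forallP => i; apply/forallP => j; apply/implyP; rewrite ltEord /=.
move: i j; apply: (@ord_homo _ (fun x y => is_true (x < y))) => [x y z|i j ij].
  exact: ltn_trans.
rewrite keyE ?neq //; have := implyP (forallP (W i) j); rewrite ij => /(_ (eqxx _)).
rewrite (leq_eqVlt (a i)) => /orP[aij|->//]; rewrite aij /=.
apply/orP; right; apply/andP; split.
  by apply/implyP => gij; apply: P; rewrite inE; apply/existsP; exists i; rewrite aij ij eqxx.
apply/implyP => gij; apply/negP => /N; rewrite !inE => /negP; apply.
by apply/existsP; exists j; rewrite aij ij eqxx.
Qed.

(** Such an [e] is [U] joined with an arbitrary subset of the complement of [U :|: D]. *)
Lemma card_interval (T : finType) (U D : {set T}) : [disjoint U & D] ->
  #|[set e : {set T} | (U \subset e) && (e \subset ~: D)]| = 2 ^ (#|T| - (#|U| + #|D|)).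
Proof.
move=> dUD; have -> : #|T| - (#|U| + #|D|) = #|~: (U :|: D)|.
  by rewrite [RHS]cardsCs setCK cardsU disjoint_setI0 // cards0 subn0.
rewrite -card_powerset.
have UI : {in powerset (~: (U :|: D)) &, injective (fun e => U :|: e)}.
  move=> e e'; rewrite !inE => /subsetP eS /subsetP eS' /setP eq; apply/setP => x.
  move: (eq x) (eS x) (eS' x); rewrite !inE.
  case: (x \in U) => /= [_|-> //].
  by case: (x \in e) => [/(_ isT)//|_]; case: (x \in e') => [/(_ isT)|].
rewrite -(card_in_imset UI); apply: eq_card => e; rewrite inE; apply/andP/imsetP.
  move=> [/subsetP Ue /subsetP eD]; exists (e :\: U).
    rewrite inE; apply/subsetP => x; rewrite !inE => /andP[/negbTE -> xe] /=.
    by have := eD x xe; rewrite inE.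
  by apply/setP => x; rewrite !inE; case xU : (x \in U) => //=; rewrite Ue.
move=> [e']; rewrite inE => /subsetP H ->; split; first exact: subsetUl.
apply/subsetP => x; rewrite !inE => /orP[xU|/H].
  by rewrite (disjointFr dUD).
by rewrite !inE negb_or => /andP[].
Qed.

(** Each tie forces one sign, of its upper element at an ascent and of its lower one at a descent,
    so the total does not depend on [g]. *)
Lemma card_forced g a : #|forced_pos g a| + #|forced_neg g a| = #|level a|.
Proof.
pose P := [set i : 'I_n | [exists j : 'I_n,
     [&& j == i.+1 :> nat, a i == a j & g i < g j]]].
(* [ordS] is the cyclic successor; it does not wrap around on [P], whose elements have a successor
   below [n]. *)
have -> : forced_pos g a = [set ordS i | i in P].
  apply/setP => j; rewrite inE; apply/existsP/imsetP => [[i /and3P[/eqP ij aij gij]]|[i]].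
    exists i; first by rewrite inE; apply/existsP; exists j; rewrite ij eqxx aij gij.
    by apply: val_inj; rewrite /= modn_small -?ij.
  rewrite inE => /existsP[k /and3P[/eqP ik aik gik]] ->; exists i.
  have -> : ordS i = k by apply: val_inj; rewrite /= modn_small -?ik.
  by rewrite ik eqxx aik gik.
rewrite card_imset; last exact: ordS_inj.
have -> : level a = P :|: forced_neg g a.
  apply/setP => i; rewrite !inE; apply/existsP/orP => [[j /andP[/eqP ij aij]]|].
    case: (ltngtP (g i) (g j)) => gij.
    - by left; apply/existsP; exists j; rewrite ij eqxx aij gij.
    - by right; apply/existsP; exists j; rewrite ij eqxx aij gij.
    - by move/val_inj/perm_inj: gij ij => ->; lia.
  by case=> /existsP[j /and3P[ij aij gij]]; exists j; rewrite ij aij.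
rewrite cardsU disjoint_setI0 ?cards0 ?subn0 // disjoint_subset.
apply/subsetP => i; rewrite !inE => /existsP[j /and3P[/eqP ij _ gij]].
apply/negP => /existsP[k /and3P[/eqP ik _ gik]].
have jk : j = k by apply: val_inj; rewrite /= ij ik.
by move: gij gik; rewrite jk => /ltn_trans H /H; rewrite ltnn.
Qed.

(** A tie ascending into [i] forces plus and a tie descending out of [i] forces minus; both together
    mean a peak at which [a] is flat. *)
Lemma disjoint_forced g a :
  [disjoint forced_pos g a & forced_neg g a] = [forall i in Peak g, ~~ flat a i].
Proof.
rewrite disjoint_subset; apply/subsetP/'forall_implyP => H i.
  rewrite inE => /existsP[j /existsP[k /and4P[ij ki gji gki]]].
  apply/negP => /existsP[j' /existsP[k' /and4P[ij' ki' aji aik]]].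
  have ? : j' = j by apply: val_inj => /=; lia.
  have ? : k' = k by apply: val_inj => /=; lia.
  subst j' k'; have := H i; rewrite !inE => /(_ _)/negP; apply.
    by apply/existsP; exists j; rewrite ij aji gji.
  by apply/existsP; exists k; rewrite ki aik gki.
rewrite !inE => /existsP[j /and3P[ij aji gji]]; apply/negP => /existsP[k /and3P[ki aik gki]].
have /H/negP : i \in Peak g.
  by rewrite inE; apply/existsP; exists j; apply/existsP; exists k; rewrite ij ki gji gki.
by apply; apply/existsP; exists j; apply/existsP; exists k; rewrite ij ki aji aik.
Qed.

Local Open Scope ring_scope.

(** The part of the coefficient that does not see [g]: without conflicts, [#|level a|] signs are
    forced and the others are free. *)
Definition chain_weight (a : 'I_n -> nat) : rat := (weakinc a)%:R * 2 ^+ (n - #|level a|).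

Lemma card_good_signs_chain g a :
  #|good_signs g a|%:R = chain_weight a * \prod_(i in Peak g) (~~ flat a i)%:R :> rat.
Proof.
rewrite /chain_weight; have -> : good_signs g a =
    if weakinc a then [set e : {set 'I_n} | (forced_pos g a \subset e)
      && (e \subset ~: forced_neg g a)] else set0.
  apply/setP => e; rewrite good_signs_chain; case: weakinc; by rewrite inE.
case: weakinc; last by rewrite cards0 !mul0r.
rewrite mul1r; case dj : [disjoint forced_pos g a & forced_neg g a].
  rewrite card_interval // card_forced card_ord natrX big1 ?mulr1 //.
  by move: dj; rewrite disjoint_forced => /'forall_implyP H i /H ->.
move: (dj); rewrite disjoint_forced => /negbT; rewrite negb_forall => /existsP[i].
rewrite negb_imply negbK => /andP[iP fi]; rewrite (bigD1 i) //= fi mul0r mulr0.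
apply/eqP; rewrite pnatr_eq0 cards_eq0; apply/eqP/setP => e; rewrite !inE.
apply/negP => /andP[/subset_trans H /H]; by rewrite -disjoints_subset dj.
Qed.

Definition word_weight (s : 'S_n) (w : seq nat) : rat :=
  (size w == n)%:R * chain_weight (fun i => nth 0%N w (s i)).

Lemma KchainE g s w : Kchain g s w =
  word_weight s w * \prod_(i in Peak g) (~~ flat (fun i => nth 0%N w (s i)) i)%:R.
Proof.
rewrite /Kchain Kposet_card; last by exists (s^-1)%g; [exact: permK|exact: permKV].
rewrite /word_weight; case: eqP => _; last by rewrite !mul0r.
by rewrite mul1r card_good_signs_chain.
Qed.

(** * Peak sets and the coefficients of K and eta *)

Lemma peak_setP B :
  reflect ((forall i, i \in B -> (0 < i)%N && (i.+1 < n)%N) /\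
           (forall i j, i \in B -> j \in B -> j <> i.+1 :> nat)) (peak_set B).
Proof.
apply: (iffP andP) => [[/'forall_implyP H1 /'forall_implyP H2]|[H1 H2]]; split=> //.
- by move=> i j /H2 /'forall_implyP H /H /eqP.
- by apply/'forall_implyP.
- apply/'forall_implyP => i iB; apply/'forall_implyP => j jB; apply/eqP; exact: H2.
Qed.

Lemma peak_set_sub B C : C \subset B -> peak_set B -> peak_set C.
Proof.
move=> /subsetP CB /peak_setP[H1 H2]; apply/peak_setP; split=> [i /CB /H1 //|].
by move=> i j /CB iB /CB jB; apply: H2.
Qed.

Lemma Peak_peak_set g : peak_set (Peak g).
Proof.
apply/peak_setP; split=> [i|i j]; rewrite !inE.
  by move=> /existsP[j /existsP[k /and4P[/eqP ij /eqP <- _ _]]]; rewrite ij ltn_ord.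
move=> /existsP[x /existsP[k /and4P[_ /eqP ki _ gki]]].
move=> /existsP[y /existsP[z /and4P[/eqP jy _ gyj _]]] ji.
have ? : y = i by apply: val_inj => /=; lia.
have ? : k = j by apply: val_inj => /=; lia.
by subst y k; move: gki gyj => /ltn_trans H /H; rewrite ltnn.
Qed.

(* Labels i off B and n + i on B give peaks exactly at B. *)
Lemma exists_Peak B : peak_set B -> exists g, Peak g = B.
Proof.
move=> /peak_setP[H1 H2]; pose k (i : 'I_n) := (i + (if i \in B then n else 0))%N.
have kI : injective k.
  move=> i j; rewrite /k => eq; apply: val_inj => /=; have := ltn_ord i; have := ltn_ord j.
  by move: eq; case: (i \in B); case: (j \in B); lia.
have [g gE] := perm_rank kI; exists g; apply/setP => i; rewrite inE.
apply/existsP/idP => [[x /existsP[y /and4P[/eqP ix /eqP yi]]]|iB].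
  rewrite !gE /k => _; case: (i \in B) => //; lia.
have /andP[i0 iN] := H1 i iB; have iN' : (i.-1 < n)%N by lia.
exists (Ordinal iN'); apply/existsP; exists (Ordinal iN); apply/and4P; split => //=.
- by rewrite prednK.
- rewrite gE /k iB; case: ifP => /= [xB|_]; last by lia.
  by case: (H2 _ _ xB iB); rewrite /= prednK.
- rewrite gE /k iB; case: ifP => /= [xB|_]; last by have := ltn_ord i; lia.
  by case: (H2 _ _ iB xB).
Qed.

Lemma KpeakE B s w : peak_set B -> Kpeak B s w =
  word_weight s w * \prod_(i in B) (~~ flat (fun i => nth 0%N w (s i)) i)%:R.
Proof.
move=> /exists_Peak[g0 g0B]; rewrite /Kpeak; case: pickP => [g /eqP <-|/(_ g0)].
  exact: KchainE.
by rewrite g0B eqxx.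
Qed.

(** Coefficients see [g] only through [Peak g], so the representative picked in [Kpeak] does not
    matter. *)
Lemma Kchain_Kpeak g s : Kchain g s = Kpeak (Peak g) s.
Proof. by apply/funext => w; rewrite KchainE KpeakE ?Peak_peak_set. Qed.

(** Expanding the product picks [x i] or 1 in each factor; factors off [B] are written [0 + 1],
    which kills the subsets not inside [B]. *)
Lemma sum_subset_prod (R : comPzRingType) (I : finType) (B : {set I}) (x : I -> R) :
  \sum_(C : {set I} | C \subset B) \prod_(i in C) x i = \prod_(i in B) (1 + x i).
Proof.
rewrite [RHS]big_mkcond /=.
rewrite (eq_bigr (fun i => (if i \in B then x i else 0) + 1)); last first.
  by move=> i _; case: ifP => _; rewrite ?add0r // addrC.
rewrite bigA_distr big_mkcond /=; apply: eq_bigr => C _.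
case: ifPn => [/subsetP CB|/subsetPn[i iC iB]].
  by rewrite [LHS]big_mkcond; apply: eq_bigr => i _; case: ifP => // /CB ->.
by rewrite (bigD1 i) //= iC (negbTE iB) mul0r.
Qed.

(** Apply [sum_subset_prod] with [x i] equal to minus the indicator of not being flat, so that
    [1 + x i] indicates flatness. *)
Lemma etaE B s w : peak_set B -> eta B s w =
  word_weight s w * ((-1) ^+ #|B| * \prod_(i in B) (flat (fun i => nth 0%N w (s i)) i)%:R).
Proof.
move=> pB; pose a i := nth 0%N w (s i).
rewrite /eta ncseries_sumE (eq_bigr (fun C : {set 'I_n} => word_weight s w * (-1) ^+ #|B| *
    \prod_(i in C) - (~~ flat a i)%:R)); last first.
  move=> C CB; rewrite -[LHS]/(_ * Kpeak C s w) KpeakE ?(peak_set_sub CB) // prodrN.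
  rewrite -signr_odd oddB ?subset_leq_card //.
  by rewrite signr_addb !signr_odd; ring.
rewrite -mulr_sumr sum_subset_prod mulrA; congr (_ * _); apply: eq_bigr => i _.
by rewrite -/(a _); case: flat; rewrite /= ?subr0 ?subrr.
Qed.

(** Moebius inversion, read off coefficientwise with [x i] minus the indicator of flatness. *)
Lemma Kpeak_eta B s : peak_set B ->
  Kpeak B s = \sum_(C : {set 'I_n} | C \subset B) eta C s.
Proof.
move=> pB; apply/funext => w; pose a i := nth 0%N w (s i).
rewrite ncseries_sumE KpeakE // (eq_bigr (fun C : {set 'I_n} => word_weight s w *
    \prod_(i in C) - (flat a i)%:R)); last first.
  by move=> C CB; rewrite etaE ?(peak_set_sub CB) // prodrN.
rewrite -mulr_sumr sum_subset_prod; congr (_ * _); apply: eq_bigr => i _.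
by rewrite -/(a _); case: flat; rewrite /= ?subr0 ?subrr.
Qed.

End Chains.

(** * Blocks of a pair *)

Section Blocks.
Variable n : nat.
Implicit Types (a : 'I_n -> nat) (s : 'S_n) (B C : {set 'I_n}).

(** Index, from 0, of the block containing position [i] when the positions are cut after each
    element of [Odd B]. *)
Definition block B (i : 'I_n) : nat := #|[set j in Odd B | j < i]|.

Lemma OddP B (i j : 'I_n) : j = i.+1 :> nat ->
  (i \in Odd B) = (i \notin B) && (j \notin B).
Proof.
move=> ij; rewrite inE -ij ltn_ord /=; congr andb.
apply/'forall_implyP/idP => [H|jB x xB].
  by apply/negP => /H; rewrite eqxx.
by apply: contra jB => /eqP/val_inj <-.
Qed.

Lemma Odd_lt B i : i \in Odd B -> i.+1 < n.
Proof. by rewrite inE => /and3P[]. Qed.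

Lemma Odd_sub B C : C \subset B -> Odd B \subset Odd C.
Proof.
move=> /subsetP CB; apply/subsetP => i iO; have iN := Odd_lt iO.
move: iO; rewrite !(@OddP _ _ (Ordinal iN)) // => /andP[iB jB].
by apply/andP; split; [apply: contra iB|apply: contra jB] => /CB.
Qed.

(** A peak set is recovered from left to right: position 0 is outside; after a member comes a
    non-member; after a non-member [i], the next is a member iff [i] is not in [Odd B]. *)
Lemma Odd_inj B C : peak_set B -> peak_set C -> Odd B = Odd C -> B = C.
Proof.
move=> /peak_setP[B1 B2] /peak_setP[C1 C2] eq; apply/setP => -[i iN].
elim: i iN => [|i IHi] iN.
  by apply/idP/idP => [/B1/andP[]|/C1/andP[]].
have iN' := ltnW iN; have := IHi iN'; set x := Ordinal iN'; set y := Ordinal iN => xBC.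
have := OddP B (erefl : y = x.+1 :> nat); have := OddP C (erefl : y = x.+1 :> nat).
have := B2 x y; have := C2 x y; rewrite eq xBC; case: (x \in C) => /=.
  by case: (y \in B) => [_ /(_ isT isT erefl)//|]; case: (y \in C) => [/(_ isT isT erefl)|].
by move=> _ _ ->; case: (y \in B); case: (y \in C).
Qed.

Lemma blockS B (i j : 'I_n) : j = i.+1 :> nat -> block B j = block B i + (i \in Odd B).
Proof.
move=> ij; rewrite /block; move: (Odd B) => O; case iO : (i \in O).
  rewrite (cardsD1 i) inE iO ij leqnn addnC; congr (_ + _).
  apply: eq_card => x; rewrite !inE ltnS (ltn_neqAle x) -val_eqE.
  by case: (x \in O); rewrite ?andbF.
rewrite addn0; apply: eq_card => x; rewrite !inE ij ltnS.
by case: (ltngtP x i) => // /val_inj ->; rewrite iO.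
Qed.

Lemma weakinc_block B : weakinc (block B).
Proof.
by apply/forallP => i; apply/forallP => j; apply/implyP => /eqP /(blockS B) ->; rewrite leq_addr.
Qed.

(** A step from [i] to [i + 1] is uncut exactly when one of its ends lies in [B], and flatness at a
    peak is equality across the two steps around it. *)
Lemma flatP B a : peak_set B ->
  reflect (forall i j : 'I_n, j = i.+1 :> nat -> i \notin Odd B -> a i = a j)
    [forall i in B, flat a i].
Proof.
move=> /peak_setP[B1 _]; apply: (iffP 'forall_implyP) => [H i j ij|H i iB].
  rewrite (OddP B ij) negb_and !negbK => /orP[] /H /existsP[x /existsP[y /and4P]].
    by move=> [_ /eqP iy _ /eqP ->]; congr a; apply: val_inj; rewrite /= iy ij.
  by move=> [/eqP jx _ /eqP <- _]; congr a; apply: val_inj; move: jx; rewrite /= ij => -[].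
have /andP[i0 iN] := B1 i iB; have iN' : i.-1 < n by lia.
apply/existsP; exists (Ordinal iN'); apply/existsP; exists (Ordinal iN) => /=.
have ii : i = (Ordinal iN').+1 :> nat by rewrite /= prednK.
rewrite -ii !eqxx /=; apply/andP; split; apply/eqP; apply: H => //.
  by rewrite (OddP B ii) iB andbF.
by rewrite (@OddP B i (Ordinal iN)) // iB.
Qed.

Lemma eq_on_block B a : peak_set B -> [forall i in B, flat a i] ->
  forall i j, block B i = block B j -> a i = a j.
Proof.
move=> pB /(flatP _ pB) H.
have lt (i j : 'I_n) : i < j -> block B i <= block B j /\ (block B i = block B j -> a i = a j).
  (* [r] is transitive because block indices only grow: equal indices at both ends force the middle
     one to agree. *)
  pose r (x y : nat * nat) := x.1 <= y.1 /\ (x.1 = y.1 -> x.2 = y.2).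
  apply: (@ord_homo _ r n (fun i => (block B i, a i))).
    move=> [x1 x2] [y1 y2] [z1 z2] [xy xy'] [yz yz']; split => /=; first exact: leq_trans yz.
    move=> xz; simpl in *; have yx : x1 = y1 by lia.
    by rewrite xy' // yz' // -xz yx.
  move=> x y xy; split => /=; rewrite (blockS B xy) ?leq_addr //.
  by case xO : (x \in Odd B); [lia|move=> _; apply: H => //; rewrite xO].
by move=> i j; case: (ltngtP i j) => [/lt[]//|/lt[_ {}H] /esym/H|/val_inj ->].
Qed.

(** The set composition of the pair as a function: [p.2^-1 i] is the position of the element [i], so
    the value is the index of its block. *)
Definition block_word (p : {set 'I_n} * 'S_n) (i : 'I_n) : nat := block p.1 ((p.2^-1)%g i).

(** If the letters read along [s] are flat on [B], they are constant on blocks, so reading along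
    [s'] gives the same sequence; if flatness fails for both, both coefficients vanish. *)
Lemma eta_block_word B s s' : peak_set B ->
  block_word (B, s) =1 block_word (B, s') -> eta B s = eta B s'.
Proof.
move=> pB ss'; apply/funext => w; rewrite !etaE //.
have key t t' : block_word (B, t) =1 block_word (B, t') ->
    [forall i in B, flat (fun i => nth 0 w (t i)) i] ->
    (fun i => nth 0 w (t' i)) = (fun i => nth 0 w (t i)).
  move=> tt' F; apply/funext => i; have := eq_on_block pB F.
  move/(_ (t^-1 (t' i))%g i); rewrite permKV; apply.
  by have := tt' (t' i); rewrite /block_word /= permK.
have zero t : ~~ [forall i in B, flat (fun i => nth 0 w (t i)) i] ->
    (\prod_(i in B) (flat (fun i => nth 0 w (t i)) i)%:R = 0 :> rat)%R.
  rewrite negb_forall => /existsP[i]; rewrite negb_imply => /andP[iB /negbTE fi].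
  by rewrite (bigD1 i) //= fi mul0r.
case: (boolP [forall i in B, flat (fun i => nth 0 w (s i)) i]) => [/(key _ _ ss') E|F].
  by rewrite /word_weight E.
case: (boolP [forall i in B, flat (fun i => nth 0 w (s' i)) i]) => [|F'].
  by move=> /(key _ _ (fsym ss')) E; rewrite /word_weight E.
by rewrite !zero // !mulr0.
Qed.

(** * Stable sorting and standardization *)

Definition stable_key (u : 'I_n -> nat) (i : 'I_n) : nat := u i * n + i.

Lemma stable_keyE u (i j : 'I_n) :
  (stable_key u i < stable_key u j) = (u i < u j) || (u i == u j) && (i < j).
Proof.
have := ltn_ord i; have := ltn_ord j; rewrite /stable_key.
case: (ltngtP (u i) (u j)) => /= [H|H|->]; last by rewrite ltn_add2l.
  by have := leq_mul H (leqnn n); lia.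
by have := leq_mul H (leqnn n); lia.
Qed.

Lemma stable_key_inj u : injective (stable_key u).
Proof.
move=> i j eq; have := stable_keyE u i j; have := stable_keyE u j i.
rewrite eq ltnn; case: ltngtP => //= _; case: ltngtP => //.
by move=> /val_inj.
Qed.

Lemma stable_sort u : exists s : 'S_n,
  weakinc (u \o s) /\ forall i j : 'I_n, j = i.+1 :> nat -> u (s i) = u (s j) -> s i < s j.
Proof.
have [s sE] := perm_sort (@stable_key_inj u); exists s; split.
  apply/weakincP => i j; rewrite -sE stable_keyE /= => /orP[/ltnW //|/andP[/eqP -> //]].
move=> i j ij eq; have : i < j by rewrite ij.
by rewrite -sE stable_keyE eq ltnn eqxx.
Qed.

(** The block index grows at a cut, and elsewhere [s] has no descent. Hence [s] is the stable sort
    of its own block word, which makes it unique. *)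
Lemma enriched_standard_sorts B s : enriched_standard B s ->
  forall i j : 'I_n, i < j ->
  stable_key (block_word (B, s)) (s i) < stable_key (block_word (B, s)) (s j).
Proof.
move=> /subsetP std; pose k i := stable_key (block_word (B, s)) (s i).
apply: (@ord_homo _ (fun x y => is_true (x < y)) n k) => [x y z|i j ij].
  exact: ltn_trans.
rewrite /k stable_keyE /block_word /= !permK (blockS B ij).
case iO : (i \in Odd B); first by rewrite addn1 leqnn.
rewrite addn0 ltnn eqxx /= ltnNge leq_eqVlt; apply/negP => /orP[/eqP/val_inj/perm_inj ji|sji].
  by move: ij; rewrite ji; lia.
have /std : i \in Des s by rewrite inE; apply/existsP; exists j; rewrite ij eqxx.
by rewrite iO.
Qed.

Lemma enriched_standard_of_sorted B s :
  (forall i j : 'I_n, j = i.+1 :> nat -> block B i = block B j -> s i < s j) ->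
  enriched_standard B s.
Proof.
move=> H; apply/subsetP => i; rewrite inE => /existsP[j /andP[/eqP ij sji]].
apply: contraTT sji => iO; rewrite -leqNgt ltnW // H //.
by rewrite (blockS B ij) (negbTE iO) addn0.
Qed.

(** The left side rearranges [block B], and both are weakly increasing. *)
Lemma block_word_sort B s s' : weakinc (block_word (B, s) \o s') ->
  forall i, block_word (B, s) (s' i) = block B i.
Proof.
move=> /weakincP H i.
have := @perm_sorted_eq _ (block B) (s' * s^-1)%g.
rewrite /block_word /=; move: (H); rewrite /block_word /= => H'.
move=> /(_ _ _ i); rewrite permM; apply; first by apply/weakincP/weakinc_block.
by move=> x y xy; rewrite !permM; apply: H'.
Qed.

Lemma standardize B s : exists s',
  enriched_standard B s' /\ block_word (B, s) =1 block_word (B, s').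
Proof.
have [s' [s'inc s'st]] := stable_sort (block_word (B, s)); exists s'.
have bE := block_word_sort s'inc; split.
  by apply: enriched_standard_of_sorted => i j ij; rewrite -!bE; apply: s'st.
by move=> i; rewrite -{1}[i](permKV s') bE.
Qed.

(** The test word for independence, giving each element the index of its block as a letter. *)
Definition pair_word (p : {set 'I_n} * 'S_n) : seq nat :=
  [seq block_word p i | i <- enum 'I_n].

Lemma nth_pair_word p (i : 'I_n) : nth 0 (pair_word p) i = block_word p i.
Proof. by rewrite (nth_map i) ?size_enum_ord // nth_ord_enum. Qed.

Lemma eta_neq0 B s w : peak_set B -> (eta B s w != 0)%R =
  [&& size w == n, weakinc (fun i => nth 0 w (s i)) &
     [forall i in B, flat (fun i => nth 0 w (s i)) i]].
Proof.
move=> pB; rewrite etaE // /word_weight /chain_weight !mulf_eq0 signr_eq0 /= !negb_or.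
rewrite expf_eq0 /= andbF /= andbT -andbA.
rewrite !pnatr_eq0 !eqb0 !negbK; do 2!congr andb; rewrite prodf_seq_neq0 /=.
apply/allP/'forall_implyP => H i.
  by move=> iB; have := H i (mem_index_enum _); rewrite iB /= pnatr_eq0 eqb0 negbK.
by move=> _; apply/implyP => /H ->.
Qed.

Lemma eta_pair_word (p : {set 'I_n} * 'S_n) : p \in std_pairs n ->
  (eta p.1 p.2 (pair_word p) != 0)%R.
Proof.
case: p => B s; rewrite inE /= => /andP[pB _].
rewrite eta_neq0 // size_map size_enum_ord eqxx /=.
have -> : (fun i => nth 0 (pair_word (B, s)) (s i)) = block B.
  by apply/funext => i; rewrite nth_pair_word /block_word /= permK.
rewrite weakinc_block; apply/(flatP _ pB) => i j ij iO.
by rewrite (blockS B ij) (negbTE iO) addn0.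
Qed.

(** Triangularity. Read along [t], the word of [(B, s)] becomes [block B]; it is constant on the
    blocks of [C], so [Odd B] lies in [Odd C], and the cardinals force equality. Then [B = C], and
    [s] and [t] stably sort the same block word. *)
Lemma std_pair_inj (p q : {set 'I_n} * 'S_n) :
  p \in std_pairs n -> q \in std_pairs n -> #|Odd q.1| <= #|Odd p.1| ->
  (eta q.1 q.2 (pair_word p) != 0)%R -> q = p.
Proof.
case: p q => [B s] [C t]; rewrite !inE /= => /andP[pB sB] /andP[pC tC] card.
rewrite eta_neq0 //; have wE (i : 'I_n) : nth 0 (pair_word (B, s)) i = block_word (B, s) i.
  exact: nth_pair_word.
have -> : (fun i => nth 0 (pair_word (B, s)) (t i)) = block_word (B, s) \o t.
  by apply/funext => i; rewrite wE.
move=> /and3P[_ winc F]; have bE := block_word_sort winc.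
have BC : Odd B = Odd C.
  apply/eqP; rewrite eqEcard card andbT; apply/subsetP => i iB; have iN := Odd_lt iB.
  apply: contraT => iC; move/(flatP _ pC)/(_ i (Ordinal iN) erefl iC): F.
  by rewrite /= !bE (@blockS B i (Ordinal iN)) // iB; lia.
have {BC} ? := Odd_inj pB pC BC; subst C; congr pair; symmetry.
have ww : block_word (B, t) =1 block_word (B, s).
  by move=> i; rewrite -[i](permKV t) bE /block_word /= permKV.
apply: (@perm_sort_uniq _ (stable_key (block_word (B, s)))) => i j ij.
  exact: enriched_standard_sorts.
by have := enriched_standard_sorts tC ij; rewrite /stable_key !ww.
Qed.

End Blocks.

(** * Bases *)

Section Span.
Local Open Scope ring_scope.
Variable V : lmodType rat.
Implicit Types S T : classical_sets.set V.

Lemma lin_span_gen S v : S v -> lin_span S v.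
Proof.
by exists 1%N, (fun=> 1), (fun=> v); split=> //; rewrite big_ord1 scale1r.
Qed.

Lemma lin_span_sum S (I : finType) (P : pred I) (c : I -> rat) (v : I -> V) :
  (forall i, P i -> lin_span S (v i)) -> lin_span S (\sum_(i | P i) c i *: v i).
Proof.
move=> H; elim/big_rec: _ => [|i x /H[k [c1 [g1 [g1S ->]]]] [l [c2 [g2 [g2S ->]]]]].
  by exists 0%N, (fun=> 0), (fun=> 0); split; [case|rewrite big_ord0].
exists (k + l)%N,
  (fun j => match split j with inl x => c i * c1 x | inr y => c2 y end),
  (fun j => match split j with inl x => g1 x | inr y => g2 y end).
split=> [j|]; first by case: split.
rewrite big_split_ord /= scaler_sumr; congr (_ + _); apply: eq_bigr => j _.
  by rewrite (unsplitK (inl j)) scalerA.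
by rewrite (unsplitK (inr j)).
Qed.

Lemma lin_span_min S T : (forall v, S v -> lin_span T v) ->
  (lin_span S `<=` lin_span T)%classic.
Proof.
by move=> ST _ [k [c [g [gS ->]]]]; apply: lin_span_sum => i _; apply: ST.
Qed.

End Span.

Lemma Kposet_sum_chain (d : Order.disp_t) (X : finPOrderType d) (n : nat)
    (g s : X -> 'I_n) : bijective g -> bijective s ->
  exists h : 'S_n,
    Kposet g s = (\sum_(p : 'S_n | linear_extension s p) Kchain (p * h)%g p)%R.
Proof.
move=> gB sB; case: (sB) => t sK tK.
have hI : injective (fun i => g (t i)) by move=> i j /(bij_inj gB)/(can_inj tK).
exists (perm hI); apply/funext => w; rewrite ncseries_sumE Kposet_card //.
rewrite /Kchain; under eq_bigr => p _.
  rewrite Kposet_card; last by exists (p^-1)%g; [exact: permK|exact: permKV].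
  over.
case: eqP => _; last by rewrite big1.
rewrite (card_good_signs (h := perm hI) (fun i => nth 0%N w i) sK tK) ?natr_sum //.
by move=> i; rewrite permE.
Qed.

Section Bases.
Local Open Scope ring_scope.
Variable n : nat.
Let P : {set {set 'I_n} * 'S_n} := std_pairs n.
Let E (p : {set 'I_n} * 'S_n) : ncseries := eta p.1 p.2.
Let K (p : {set 'I_n} * 'S_n) : ncseries := Kpeak p.1 p.2.
Let Espan := lin_span (fun w => exists2 i, i \in P & w = E i).
Let Kspan := lin_span (fun w => exists2 i, i \in P & w = K i).

(** Shrinking [B] enlarges [Odd B], so the descents of [s] stay allowed. *)
Lemma std_pairs_sub (B C : {set 'I_n}) (s : 'S_n) :
  C \subset B -> (B, s) \in P -> (C, s) \in P.
Proof.
move=> CB; rewrite !inE /= => /andP[pB sB]; rewrite (peak_set_sub CB) //.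
exact: subset_trans sB (Odd_sub CB).
Qed.

Lemma Kpeak_NCPi (B : {set 'I_n}) (s : 'S_n) : peak_set B -> NCPi n (Kpeak B s).
Proof.
move=> /exists_Peak[g <-]; rewrite -Kchain_Kpeak; apply: lin_span_gen.
exists _, ('I_n : finPOrderType _), g, s; split=> //.
  by exists (g^-1)%g; [exact: permK|exact: permKV].
by exists (s^-1)%g; [exact: permK|exact: permKV].
Qed.

Lemma eta_std_span (B : {set 'I_n}) (s : 'S_n) : peak_set B -> Espan (eta B s).
Proof.
move=> pB; have [s' [std bE]] := standardize B s.
rewrite (eta_block_word pB bE); apply: lin_span_gen.
by exists (B, s') => //; rewrite inE pB.
Qed.

Lemma NCPi_sub_Espan : (NCPi n `<=` Espan)%classic.
Proof.
apply: lin_span_min => _ [d [X [g [s [gB sB ->]]]]].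
have [h ->] := Kposet_sum_chain gB sB.
under eq_bigr => p _ do rewrite Kchain_Kpeak -[Kpeak _ _]scale1r.
apply: lin_span_sum => p _; rewrite Kpeak_eta ?Peak_peak_set //.
under eq_bigr => C _ do rewrite -[eta _ _]scale1r.
apply: lin_span_sum => C CB; apply: eta_std_span.
exact: peak_set_sub CB (Peak_peak_set _).
Qed.

Lemma Kspan_sub_NCPi : (Kspan `<=` NCPi n)%classic.
Proof.
apply: lin_span_min => _ [[B s] + ->]; rewrite inE => /andP[pB _].
exact: Kpeak_NCPi.
Qed.

Lemma Espan_sub_Kspan : (Espan `<=` Kspan)%classic.
Proof.
apply: lin_span_min => _ [[B s] BsP ->]; apply: lin_span_sum => C CB.
by apply: lin_span_gen; exists (C, s) => //; apply: std_pairs_sub CB BsP.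
Qed.

Lemma Espan_NCPi : Espan = NCPi n.
Proof.
apply/seteqP; split; last exact: NCPi_sub_Espan.
by move=> v /Espan_sub_Kspan /Kspan_sub_NCPi.
Qed.

Lemma Kspan_NCPi : Kspan = NCPi n.
Proof.
apply/seteqP; split; first exact: Kspan_sub_NCPi.
by move=> v /NCPi_sub_Espan /Espan_sub_Kspan.
Qed.

(** Among the pairs with nonzero coefficient take [p] with [Odd p.1] largest; by [std_pair_inj],
    evaluation at [pair_word p] leaves only the term of [p]. *)
Lemma eta_free (c : {set 'I_n} * 'S_n -> rat) :
  \sum_(p in P) c p *: E p = 0 -> forall p, p \in P -> c p = 0.
Proof.
move=> c0 p0 p0P; apply/eqP/negPn/negP => cp0.
pose Q := [pred p | (p \in P) && (c p != 0)].
have Qp0 : Q p0 by rewrite /= p0P.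
have [p /andP[pP cp] pmax] := @arg_maxnP _ p0 Q (fun p => #|Odd p.1|) Qp0.
have := congr1 (fun F : ncseries => F (pair_word p)) c0.
rewrite ncseries_sumE (bigD1 p) //= big1 => [|q /andP[qP qp]].
  rewrite addr0 => /eqP; rewrite -[_ == _]/(c p * E p (pair_word p) == 0).
  by rewrite mulf_eq0 (negbTE cp) (negbTE (eta_pair_word pP)).
rewrite -[LHS]/(c q * E q (pair_word p)); apply/eqP; rewrite mulf_eq0.
apply: contraNT qp; rewrite negb_or => /andP[cq Eq].
apply/eqP; apply: std_pair_inj => //; apply: pmax.
by rewrite /= qP.
Qed.

Lemma Kpeak_std_sum (p : {set 'I_n} * 'S_n) : p \in P ->
  K p = \sum_(q in P | (q.2 == p.2) && (q.1 \subset p.1)) E q.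
Proof.
case: p => B s pP; have /andP[/= pB _] : peak_set B && enriched_standard B s.
  by move: pP; rewrite inE.
rewrite /K /= Kpeak_eta //.
rewrite (reindex_onto (fun C => (C, s)) (fun q : {set 'I_n} * 'S_n => q.1)) /=.
  apply: eq_bigl => C; rewrite !eqxx /= andbT; apply/idP/andP => [CB|[]//].
  by split=> //; apply: std_pairs_sub CB pP.
by move=> [C t] /= /and3P[_ /eqP -> _].
Qed.

Lemma Kpeak_free (c : {set 'I_n} * 'S_n -> rat) :
  \sum_(p in P) c p *: K p = 0 -> forall p, p \in P -> c p = 0.
Proof.
move=> c0.
(* [d q] is the coefficient of [E q] once every [K p] is expanded; at a [p] with [c p] nonzero and
   [p.1] of maximal size it reduces to [c p]. *)
pose d (q : {set 'I_n} * 'S_n) := \sum_(p in P | (q.2 == p.2) && (q.1 \subset p.1)) c p.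
have d0 : forall q, q \in P -> d q = 0.
  apply: eta_free; rewrite -[RHS]c0.
  under [RHS]eq_bigr => p pP do rewrite Kpeak_std_sum // scaler_sumr big_mkcondr.
  rewrite exchange_big /=; apply: eq_bigr => q _.
  by rewrite /d scaler_suml -big_mkcondr.
move=> p0 p0P; apply/eqP/negPn/negP => cp0.
pose Q := [pred p | (p \in P) && (c p != 0)].
have Qp0 : Q p0 by rewrite /= p0P.
have [p /andP[pP cp] pmax] := @arg_maxnP _ p0 Q (fun p => #|p.1|) Qp0.
have := d0 p pP; rewrite /d (bigD1 p) ?pP ?eqxx ?subxx //= big1 => [|q].
  by rewrite addr0 => /eqP; rewrite (negbTE cp).
move=> /andP[/and3P[qP /eqP pq2 pq1] qp]; apply/eqP; apply: contraNT qp => cq.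
have := pmax q; rewrite /= qP cq => /(_ isT) card.
case: p q pq1 pq2 card {pP qP cp cq pmax} => [B s] [C t] /= BC -> CB.
by rewrite (_ : C = B) //; apply/eqP; rewrite eq_sym eqEcard BC.
Qed.

Lemma eta_basis : is_basis P E (NCPi n).
Proof. by split; [exact: Espan_NCPi|exact: eta_free]. Qed.

Lemma Kpeak_basis : is_basis P K (NCPi n).
Proof. by split; [exact: Kspan_NCPi|exact: Kpeak_free]. Qed.

End Bases.

Lemma is_basis_dim (V : lmodType rat) (I : finType) (A : {set I}) (v : I -> V)
    (W : classical_sets.set V) : is_basis A v W -> has_dim W #|A|.
Proof.
move=> [span free]; exists (fun i => v (enum_val i)); split.
  rewrite -span; congr lin_span; apply/funext => w; apply/propext; split.
    by move=> [i _ ->]; exists (enum_val i) => //; apply: enum_valP.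
  by move=> [i iA ->]; exists (enum_rank_in iA i); rewrite ?inE ?enum_rankK_in.
(* [enum_rank_in] needs an element of [A] for its default; the index [i] provides one. *)
move=> c c0 i _; pose c' j := c (enum_rank_in (enum_valP i) j).
rewrite -(enum_valK_in (enum_valP i) i) -/(c' _); apply: free (enum_valP i).
rewrite -[RHS]c0 big_enum_val [RHS](eq_bigl xpredT) => [|j]; last by rewrite inE.
by apply: eq_bigr => j _; rewrite /c' enum_valK_in.
Qed.

(** * Counting odd set compositions *)

Section Compositions.
Variable n : nat.
Implicit Types (u a : 'I_n -> nat) (c : seq {set 'I_n}).

Definition fiber u (k : nat) : {set 'I_n} := [set i | u i == k].

(** The bound [n] suffices for functions onto some [0, ..., m - 1]; the filter spares carrying [m]
    along. *)
Definition composition_of u : seq {set 'I_n} :=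
  [seq A <- [seq fiber u k | k <- iota 0 n] | A != set0].

Definition onto_prefix u (m : nat) : Prop :=
  (forall i, u i < m) /\ (forall k, k < m -> exists i, u i = k).

Lemma composition_ofE u m : onto_prefix u m ->
  composition_of u = [seq fiber u k | k <- iota 0 m].
Proof.
move=> [um mu]; have mn : m <= n.
  rewrite -(size_iota 0 m) -(card_ord n) -(size_codom u).
  apply: uniq_leq_size; first exact: iota_uniq.
  by move=> k; rewrite mem_iota /= => /mu[i <-]; apply: codom_f.
have -> : composition_of u =
    [seq A <- [seq fiber u k | k <- iota 0 m ++ iota m (n - m)] | A != set0].
  by rewrite -iotaD subnKC.
rewrite map_cat filter_cat.
rewrite [X in _ ++ X](_ : _ = [::]) ?cats0.
  apply/all_filterP; rewrite all_map; apply/allP => k; rewrite mem_iota => /mu[i ui] /=.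
  by apply/set0Pn; exists i; rewrite inE ui.
apply/eqP; rewrite -size_eq0 size_filter -leqn0 leqNgt -has_count has_map.
apply/hasPn => k; rewrite mem_iota => /andP[mk _] /=; rewrite negbK.
by apply/eqP/setP => i; rewrite !inE; apply/eqP => ui; have := um i; rewrite ui ltnNge mk.
Qed.

Lemma find_composition_of u m : onto_prefix u m ->
  forall i, find (fun A : {set 'I_n} => i \in A) (composition_of u) = u i.
Proof.
move=> um i; rewrite (composition_ofE um) find_map.
rewrite (eq_find (a2 := pred1 (u i))) => [|k]; last by rewrite /= inE eq_sym.
have uim : u i < m by case: um.
rewrite -[LHS]/(index (u i) (iota 0 m)) -{1}[u i]add0n -(nth_iota 0 0 uim).
by rewrite index_uniq ?size_iota ?iota_uniq.
Qed.

(** [block B] starts at 0 and grows by at most 1 per step, so it skips no value. *)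
Lemma onto_prefix_block (B : {set 'I_n}) (s : 'S_n) :
  exists m, onto_prefix (block_word (B, s)) m.
Proof.
have down (i : 'I_n) k : k < block B i -> exists j, block B j = k.
  case: i => i; elim: i => [|i IHi] iN.
    rewrite /block (_ : [set _ in _ | _] = set0) ?cards0 //.
    by apply/setP => j; rewrite !inE andbF.
  rewrite (@blockS _ B (Ordinal (ltnW iN))) //.
  case: (ltngtP k (block B (Ordinal (ltnW iN)))) => [/IHi //|kb|->].
    by case: (_ \in _) => /=; lia.
  by exists (Ordinal (ltnW iN)).
(* The number of blocks, which is 0 for [n = 0]. *)
exists (\max_(i < n) (block B i).+1); split=> [i|k].
  exact: (@leq_bigmax _ (fun i => (block B i).+1)).
case: (posnP n) => [n0|n0].
  by rewrite big1 // => i; have := leq_trans (ltn_ord i) (eq_leq n0).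
have [|i ->] := @bigop.eq_bigmax _ (fun i => (block B i).+1); first by rewrite card_ord.
rewrite ltnS leq_eqVlt => /orP[/eqP ->|/down[j jk]].
  by exists (s i); rewrite /block_word /= permK.
by exists (s j); rewrite /block_word /= permK.
Qed.

(* A peak set occupies the odd offsets of the runs of [block B]; conversely, odd run
   lengths make the set of odd offsets a peak set. *)
Definition offset a (i : 'I_n) : nat := #|[set j : 'I_n | (j < i) && (a j == a i)]|.

Lemma offset0 a (i : 'I_n) : i = 0 :> nat -> offset a i = 0.
Proof.
by move=> i0; apply/eqP; rewrite cards_eq0; apply/eqP/setP => j; rewrite !inE i0.
Qed.

Lemma offsetS a (i j : 'I_n) : weakinc a -> j = i.+1 :> nat ->
  offset a j = if a i == a j then (offset a i).+1 else 0.
Proof.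
move=> /weakincP ainc ij; case: eqP => [aij|aij].
  rewrite /offset (cardsD1 i) inE aij eqxx ij leqnn add1n; congr _.+1.
  apply: eq_card => x; rewrite !inE ltnS (ltn_neqAle x) -val_eqE.
  by rewrite andbA.
apply/eqP; rewrite cards_eq0; apply/eqP/setP => x; rewrite !inE ij ltnS.
apply/negP => /andP[xi /eqP axj].
have axi : a x <= a i by move: xi; rewrite leq_eqVlt => /orP[/eqP/val_inj ->|/ainc].
by have := ainc i j; rewrite ij leqnn => /(_ isT); lia.
Qed.

Lemma offset_last a (i : 'I_n) : weakinc a ->
  (forall j : 'I_n, j = i.+1 :> nat -> a i <> a j) -> #|fiber a (a i)| = (offset a i).+1.
Proof.
move=> /weakincP ainc last; rewrite (cardsD1 i) inE eqxx add1n; congr _.+1.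
apply: eq_card => x; rewrite !inE -val_eqE.
case: (ltngtP x i) => //= ix; apply/eqP => axi.
have jN : i.+1 < n := leq_ltn_trans ix (ltn_ord x).
have := last (Ordinal jN) erefl; have := ainc i (Ordinal jN) (leqnn _).
suff : a (Ordinal jN) <= a x by lia.
move: ix; rewrite leq_eqVlt => /orP[/eqP e|/(ainc (Ordinal jN))//].
by rewrite (_ : Ordinal jN = x) //; apply: val_inj.
Qed.

(** An uncut step has exactly one end in [B], since [B] has no two consecutive members, so
    membership alternates like the parity of the offset; after a cut the offset restarts at 0,
    outside [B]. *)
Lemma odd_offset_block (B : {set 'I_n}) (i : 'I_n) : peak_set B ->
  odd (offset (block B) i) = (i \in B).
Proof.
move=> pB; have /peak_setP[B1 B2] := pB; case: i => i; elim: i => [|i IHi] iN.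
  by rewrite offset0 //; apply/esym/negbTE/negP => /B1/andP[].
set j := Ordinal iN; pose x := Ordinal (ltnW iN).
have xj : j = x.+1 :> nat by [].
rewrite (offsetS (weakinc_block B) xj) (blockS B xj) (OddP B xj).
have := B2 x j; have := IHi (ltnW iN); rewrite -/x.
case: (x \in B); case: (j \in B) => /=; rewrite ?addn0 ?addn1 ?eqxx /=.
- by move=> _ /(_ isT isT xj).
- by move=> ->.
- by move=> ->.
- by rewrite ltn_eqF.
Qed.

(** The last position of a block is not in [B], as a peak has a next position in its own block; its
    offset is therefore even, and the block has one more element. *)
Lemma odd_fiber_block (B : {set 'I_n}) k : peak_set B ->
  fiber (block B) k != set0 -> odd #|fiber (block B) k|.
Proof.
move=> pB /set0Pn[i0 i0k].
have [i ik imax] := @arg_maxnP _ i0 [pred i | i \in fiber (block B) k] val i0k.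
have {ik} ik : block B i = k by move: ik; rewrite /= inE => /eqP.
have last (j : 'I_n) : j = i.+1 :> nat -> block B i <> block B j.
  move=> ij bij; have := imax j; rewrite /= inE -bij ik eqxx ij => /(_ isT) /=.
  by rewrite ltnn.
rewrite -ik (offset_last (weakinc_block B) last) /= odd_offset_block //.
apply/negP => iB; have /peak_setP[/(_ i iB)/andP[_ iN] _] := pB.
apply: (last (Ordinal iN)) => //; rewrite (@blockS _ B i (Ordinal iN)) //.
by rewrite (@OddP _ B i (Ordinal iN)) // iB addn0.
Qed.

Lemma card_fiber_perm u (s : 'S_n) k : #|fiber (u \o s) k| = #|fiber u k|.
Proof.
rewrite -(card_imset _ (@perm_inj _ s)); apply: eq_card => i; rewrite inE.
apply/imsetP/eqP => [[j]|uik]; first by rewrite inE => /eqP jk ->.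
by exists (s^-1 i)%g; rewrite ?inE /= permKV // uik.
Qed.

Lemma odd_set_composition_of_pair (p : {set 'I_n} * 'S_n) : peak_set p.1 ->
  odd_set_composition (composition_of (block_word p)).
Proof.
case: p => B s /= pB; have [m um] := onto_prefix_block B s.
rewrite (composition_ofE um) /odd_set_composition /set_composition.
have ne k : k < m -> fiber (block_word (B, s)) k != set0.
  by case: um => _ H /H[i ik]; apply/set0Pn; exists i; rewrite inE ik.
have cE k : #|fiber (block B) k| = #|fiber (block_word (B, s)) k|.
  rewrite -[RHS](card_fiber_perm _ s); apply: eq_card => i.
  by rewrite !inE /block_word /= permK.
apply/andP; split; last first.
  rewrite all_map; apply/allP => k; rewrite mem_iota /= => km.
  by rewrite -cE odd_fiber_block // -card_gt0 cE card_gt0 ne.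
apply/and3P; split.
- by apply/negP => /mapP[k]; rewrite mem_iota /= => /ne /eqP + /esym.
- rewrite pairwise_map; have := iota_uniq 0 m; rewrite uniq_pairwise.
  apply: sub_pairwise => k l kl /=; rewrite disjoint_subset.
  by apply/subsetP => i; rewrite !inE => /eqP ->.
- apply/forallP => i; rewrite has_map; apply/hasP; exists (block_word (B, s) i).
    by rewrite mem_iota /=; case: um.
  by rewrite /= inE.
Qed.

(** * From an odd set composition back to an enriched standard pair *)

Lemma mem_pairwise_disjoint (T : finType) (c : seq {set T}) (i : T) k l :
  pairwise (fun A B : {set T} => [disjoint A & B]) c ->
  k < size c -> l < size c -> i \in nth set0 c k -> i \in nth set0 c l -> k = l.
Proof.
move=> /(pairwiseP set0) H kc lc ik il.
case: (ltngtP k l) => // kl.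
  by have := disjointFr (H k l kc lc kl) ik; rewrite il.
by have := disjointFr (H l k lc kc kl) il; rewrite ik.
Qed.

(** Let [u] give the block index of each element and [s] its stable sort, so that the blocks become
    the runs of [a]; the peak set consists of the odd offsets in these runs. *)
Lemma composition_of_pair_surj c : odd_set_composition c ->
  exists2 p, p \in std_pairs n & c = composition_of (block_word p).
Proof.
move=> /andP[/and3P[c0 cdisj /forallP ccov] codd].
pose u (i : 'I_n) := find (fun A : {set 'I_n} => i \in A) c.
have uc i : u i < size c by rewrite -has_find.
have uE i k : k < size c -> (u i == k) = (i \in nth set0 c k).
  move=> kc; have iu := nth_find set0 (ccov i).
  apply/eqP/idP => [<- //|ik]; exact: (mem_pairwise_disjoint cdisj (uc i) kc iu ik).
have fibE k : k < size c -> fiber u k = nth set0 c k.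
  by move=> kc; apply/setP => i; rewrite inE uE.
have upre : onto_prefix u (size c).
  split=> // k kc; have /set0Pn[i] : nth set0 c k != set0.
    by apply: contraNneq c0 => <-; apply: mem_nth.
  by rewrite -uE // => /eqP; exists i.
have [s [ainc astab]] := stable_sort u; set a := u \o s in ainc.
have apre : onto_prefix a (size c).
  split=> [i|k /(proj2 upre)[i <-]]; first exact: uc.
  by exists (s^-1 i)%g; rewrite /a /= permKV.
have aodd i : odd #|fiber a (a i)|.
  rewrite card_fiber_perm fibE ?(proj1 apre) //; apply: (allP codd).
  exact/mem_nth/(proj1 apre).
pose B := [set i | odd (offset a i)].
have BE i : (i \in B) = odd (offset a i) by rewrite inE.
have offS (i j : 'I_n) (ij : j = i.+1 :> nat) := offsetS ainc ij.
have last (i j : 'I_n) : j = i.+1 :> nat -> a i <> a j -> ~~ odd (offset a i).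
  move=> ij aij; have := aodd i; rewrite (offset_last ainc) //= => k ik.
  by rewrite (_ : k = j) //; apply: val_inj; rewrite /= ij.
(* Inside a run consecutive offsets differ in parity, so one end lies in [B]; at a run end the
   offset is even, as runs have odd size, and the next offset is 0. *)
have OE (i j : 'I_n) : j = i.+1 :> nat -> (i \in Odd B) = (a i != a j).
  move=> ij; rewrite (OddP B ij) !BE (offS _ _ ij); case: eqP => [_|/(last _ _ ij) -> //].
  by rewrite /= negbK andNb.
have pB : peak_set B.
  apply/peak_setP; split=> [i|i j].
    rewrite BE => oi; apply/andP; split.
      by case: (posnP i) => // i0; rewrite offset0 in oi.
    rewrite ltnNge; apply/negP => ni; have := aodd i.
    rewrite (offset_last ainc) /= ?oi // => j ij; have := ltn_ord j.
    by rewrite ij ltnNge ni.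
  rewrite !BE => oi oj ij; move: oj; rewrite (offS _ _ ij); case: ifP => //= _.
  by rewrite oi.
(* Both sides start at 0 and grow by 1 at each run end; [a] cannot jump further, being weakly
   increasing and skipping no value. *)
have blockE : block B =1 a.
  move=> [i]; elim: i => [|i IHi] iN.
    rewrite /block (_ : [set _ in _ | _] = set0) ?cards0; last first.
      by apply/setP => j; rewrite !inE andbF.
    case: (posnP (a (Ordinal iN))) => // a0.
    have [k ak] := proj2 apre 0 (ltn_trans a0 (proj1 apre _)).
    case: (posnP k) => k0.
      by move: a0; rewrite -(_ : k = Ordinal iN) ?ak //; apply: val_inj.
    by have := (weakincP _ ainc) (Ordinal iN) k k0; rewrite ak leqNgt a0.
  set j := Ordinal iN; pose x := Ordinal (ltnW iN).
  have xj : j = x.+1 :> nat by [].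
  have aj := (weakincP _ ainc) x j; rewrite xj leqnn in aj.
  rewrite (blockS B xj) IHi (OE _ _ xj) -/x; case: eqP => [->|axj] /=; rewrite ?addn0 //.
  rewrite addn1; apply/eqP; rewrite eqn_leq; apply/andP; split.
    by rewrite ltn_neqAle aj // andbT; apply/eqP.
  rewrite leqNgt; apply/negP => gap.
  have [k ak] := proj2 apre _ (ltn_trans gap (proj1 apre _)).
  case: (leqP k x) => [|xk].
    rewrite leq_eqVlt => /orP[/eqP/val_inj kx|/(weakincP _ ainc)]; rewrite ?ak ?ltnn //.
    by move: ak; rewrite kx; lia.
  move: xk; rewrite -[x.+1]/(val j) leq_eqVlt => /orP[/eqP/val_inj kj|/(weakincP _ ainc)].
    by move: gap; rewrite kj ak ltnn.
  by rewrite ak leqNgt gap.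
have wE : block_word (B, s) = u.
  by apply/funext => i; rewrite /block_word /= blockE /a /= permKV.
exists (B, s).
  rewrite inE pB /=; apply: enriched_standard_of_sorted => i j ij.
  by rewrite !blockE; apply: astab.
rewrite wE (composition_ofE upre); apply: (@eq_from_nth _ set0).
  by rewrite size_map size_iota.
by move=> k kc; rewrite (nth_map 0) ?size_iota // nth_iota // fibE.
Qed.

(** For injectivity, equal compositions give equal block words, so each [eta] is nonzero at the word
    of the other pair and [std_pair_inj] applies. *)
Lemma num_odd_set_compositionsE : num_odd_set_compositions n = #|std_pairs n|.
Proof.
apply: (card_fset_set_image (F := fun p => composition_of (block_word p))).
  move=> [B s] [C t] p q eq.
  have [m um] := onto_prefix_block B s; have [m' um'] := onto_prefix_block C t.
  have ww : block_word (C, t) =1 block_word (B, s).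
    by move=> i; rewrite -(find_composition_of um) eq (find_composition_of um').
  have word : pair_word (C, t) = pair_word (B, s) by apply: eq_map.
  case: (leqP #|Odd B| #|Odd C|) => [le|/ltnW le].
    by apply: std_pair_inj => //=; rewrite word; apply: (eta_pair_word p).
  by apply/esym/std_pair_inj => //=; rewrite -word; apply: (eta_pair_word q).
move=> c; split; first exact: composition_of_pair_surj.
by move=> [p + ->]; rewrite inE => /andP[pB _]; apply: odd_set_composition_of_pair.
Qed.

End Compositions.

Theorem theorem7p5 (n : nat) :
  [/\ is_basis (std_pairs n) (fun p => eta p.1 p.2) (@NCPi n),
      is_basis (std_pairs n) (fun p => Kpeak p.1 p.2) (@NCPi n)
    & has_dim (@NCPi n) (num_odd_set_compositions n)].
Proof.
split; [exact: eta_basis|exact: Kpeak_basis|].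
by rewrite num_odd_set_compositionsE; apply: is_basis_dim (eta_basis n).
Qed.
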